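(* For $k=3$ agents there exists an online exploration strategy for tadpole graphs that has competitive ratio $2$ in the time model and competitive ratio $1$ in the energy model.
   Context: Multi-agent online graph exploration: an undirected connected graph $G=(V,E)$ with positive edge lengths $l(e)$ and distinctly labelled nodes is initially unknown. $k$ agents start at a node $s$; initially they know $s$, its incident edges (with lengths) and its neighbours. Whenever an agent visits a node $v$ for the first time, all edges incident to $v$ (with lengths) and the neighbours of $v$ are revealed. Agents share all information instantly, have unlimited computation, move at unit speed (traversing $e$ takes time $l(e)$), and may wait. The exploration is finished when every node has been visited and all agents are back at $s$. Time model: cost is the finishing time. Energy model: cost is the maximum total distance travelled by any single agent. $opt(G,s,k)$ is the minimum cost of an exploration by $k$ agents with full prior knowledge of $G$; a strategy has competitive ratio $c$ on a class if $c$ is the supremum of its cost divided by $opt(G,s,k)$ over all $G$ in the class and $s\in V$. A tadpole graph consists of a cycle together with a path (the tail, at least one edge) attached to one cycle node (the intersection, of degree 3); the other end of the tail has degree 1. *)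

(* Defs.v *)
From mathcomp Require Import all_boot all_order all_algebra.
From mathcomp Require Import finmap classical_sets reals.

Set Implicit Arguments.
Unset Strict Implicit.
Unset Printing Implicit Defensive.

Import Order.TTheory GRing.Theory Num.Theory.
Local Open Scope fset_scope.
Local Open Scope fmap_scope.
Local Open Scope classical_set_scope.
Local Open Scope ring_scope.

(* Nodes are labelled by natural numbers. An adjacency map sends a node to the
   finite map from its neighbours to the lengths of the connecting edges. The
   same type represents whole graphs and partial knowledge of a graph: the
   restriction [G.[& A]] of [G] to a set [A] of visited nodes consists exactly
   of the edges incident to [A], with their lengths and both end nodes. *)
Definition adjmap (R : realType) := {fmap nat -> {fmap nat -> R}}.

Section Graphs.
Variable R : realType.
Implicit Types (G : adjmap R) (p c : seq nat).

Definition edge_len G (u v : nat) : option R :=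
  if G.[? u] is Some N then N.[? v] else None.

Definition adj G : rel nat := fun u v => edge_len G u v.

(* Junk value 0 if [u] and [v] are not adjacent. *)
Definition len G (u v : nat) : R := odflt 0 (edge_len G u v).

(* Finite connected simple graphs with positive edge lengths. By symmetry every
   neighbour of a node is itself in [domf G]. *)
Definition is_graph G : Prop :=
  [/\ forall u, ~~ adj G u u,
      forall u v, edge_len G u v = edge_len G v u,
      forall u v, adj G u v -> 0 < len G u v &
      forall u v, u \in domf G -> v \in domf G ->
        exists2 p, path (adj G) u p & last u p = v].

Definition consecutive p : rel nat := fun u v =>
  ((u, v) \in zip p (behead p)) || ((v, u) \in zip p (behead p)).

(* The cycle is [x :: c], the tail is [t], the intersection is [x]. *)
Definition tadpole G : Prop :=
  exists (x : nat) (c t : seq nat),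
    [/\ uniq (x :: c ++ t), (2 <= size c)%N, (1 <= size t)%N,
        domf G =i x :: c ++ t &
        forall u v, adj G u v =
          consecutive (x :: rcons c x) u v || consecutive (x :: t) u v].

End Graphs.

(* The itinerary of one agent lists its moves (departure time, next node) in
   order. Between two moves the agent waits at a node; a move traverses the
   whole edge at unit speed. *)
Definition itinerary (R : realType) := seq (R * nat).

Definition schedule (R : realType) (k : nat) := 'I_k -> itinerary R.

Section Explorations.
Variable R : realType.
Implicit Types (G : adjmap R) (s u v : nat) (t T : R) (p : itinerary R).

(* [feasible G t u p]: [p] can be carried out by an agent that is at node [u]
   at time [t]. *)
Fixpoint feasible G t u p : Prop :=
  if p is (d, v) :: p' then
    [/\ t <= d, adj G u v & feasible G (d + len G u v) v p']
  else True.

(* Arrivals (time, node), the start counting as an arrival at time [t]. *)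
Fixpoint stops G t u p : seq (R * nat) :=
  (t, u) :: if p is (d, v) :: p' then stops G (d + len G u v) v p' else [::].

Fixpoint travelled G u p : R :=
  if p is (_, v) :: p' then len G u v + travelled G v p' else 0.

Definition moves_before t p : itinerary R := [seq m <- p | m.1 < t].

(* The node occupied at time [t], just before a possible departure at time [t];
   [None] when the agent is inside an edge. *)
Definition node_at G s p t : option nat :=
  let stop := last (0, s) (stops G 0 s (moves_before t p)) in
  if stop.1 <= t then Some stop.2 else None.

Definition visited G s k (S : schedule R k) t : {fset nat} :=
  [fset v in flatten [seq [seq a.2 | a <- stops G 0 s (S i) & a.1 <= t]
                     | i <- enum 'I_k]].

Definition finished G s k (S : schedule R k) t : Prop :=
  (domf G `<=` visited G s S t)%fset /\ forall i, node_at G s (S i) t = Some s.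

(* [S] is an exploration of [G] from [s] with finishing time [T], cut off at
   [T]. *)
Definition exploration G s k (S : schedule R k) T : Prop :=
  [/\ forall i, feasible G 0 s (S i),
      forall i m, m \in S i -> m.1 < T,
      finished G s S T &
      forall t, t < T -> ~ finished G s S t].

Inductive cost_model := Time | Energy.

Definition cost (m : cost_model) G s k (S : schedule R k) T : R :=
  match m with
  | Time => T
  | Energy => \big[Num.max/0]_(i < k) travelled G s (S i)
  end.

(* [S] depends on [G] without restriction: full prior knowledge. *)
Definition opt (m : cost_model) G s (k : nat) : R :=
  inf [set x | exists (S : schedule R k) (T : R),
                 exploration G s S T /\ x = cost m G s S T].

End Explorations.

(* An online strategy sees the start node, the current time, all earlier moves
   of all agents and the part of the graph revealed so far. It tells each agent
   currently at a node which neighbour to depart to now, [None] meaning stay. *)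
Definition strategy (R : realType) (k : nat) :=
  nat -> R -> schedule R k -> adjmap R -> 'I_k -> option nat.

Section Competitiveness.
Variables (R : realType) (k : nat).
Implicit Types (sigma : strategy R k) (G : adjmap R) (S : schedule R k).

Definition knowledge G s S (t : R) : adjmap R := G.[& visited G s S t].

(* [S] is the exploration of [G] from [s] produced by [sigma], finishing at
   [T]. Such [S] and [T] are unique, if they exist; they do not exist if
   [sigma] never completes the exploration or commands an agent to move to a
   node that is not adjacent to its position. *)
Definition run sigma G s S (T : R) : Prop :=
  exploration G s S T /\
  forall t i, t < T -> node_at G s (S i) t <> None ->
  forall v, (t, v) \in S i <->
    sigma s t (fun j => moves_before t (S j)) (knowledge G s S t) i = Some v.

Definition ratios (m : cost_model) (C : adjmap R -> Prop) sigma : set R :=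
  [set r | exists G s S T,
     [/\ is_graph G, C G, s \in domf G, run sigma G s S T &
         r = cost m G s S T / opt m G s k]].

Definition explores_all (C : adjmap R -> Prop) sigma : Prop :=
  forall G s, is_graph G -> C G -> s \in domf G ->
  exists S T, run sigma G s S T.

Definition has_competitive_ratio (m : cost_model) (C : adjmap R -> Prop)
    sigma (c : R) : Prop :=
  explores_all C sigma /\ isLub (ratios m C sigma) c.

End Competitiveness.

(* Main.v *)
(** With D the largest distance from s, every exploration costs at least 2D in
    both models, and the optimum equals 2D on a triangle with a pendant edge.
    The strategy builds the shortest-path tree of Dijkstra's algorithm, with
    only one agent moving at a time: the unvisited known node nearest to s is
    visited by an agent standing at its tree parent or, if there is none, by
    an agent still at s, which walks all the way along the tree. All degrees
    are at most 2 except for the intersection x, so such an agent always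
    exists: agents are sent out from s only to start a new branch at s or at
    x, hence at most three times. No agent ever leaves its shortest path, so
    none travels more than 2D, and the exploring phase takes the sum of the
    three depths reached, at most 3D. Finally each agent returns just in time
    to be at s at time exactly 4D. *)
Require Import Defs.
From mathcomp Require Import all_boot all_order all_algebra.
From mathcomp Require Import finmap boolp classical_sets reals.
From mathcomp Require Import lra zify.

Set Implicit Arguments.
Unset Strict Implicit.
Unset Printing Implicit Defensive.

Import Order.TTheory GRing.Theory Num.Theory.
Local Open Scope fset_scope.
Local Open Scope fmap_scope.
Local Open Scope ring_scope.

(** * Walks and itineraries *)

Section Walks.
Variable R : realType.
Implicit Types (G : adjmap R) (u v s : nat) (w q r : seq nat) (t : R)
  (p : itinerary R).

Fixpoint plen G u w : R :=
  if w is v :: w' then len G u v + plen G v w' else 0.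

Lemma plen_cat G u w r : plen G u (w ++ r) = plen G u w + plen G (last u w) r.
Proof. by elim: w u => [|v w IH] u /=; rewrite ?add0r // IH addrA. Qed.

Lemma plen_rcons G u w v :
  plen G u (rcons w v) = plen G u w + len G (last u w) v.
Proof. by rewrite -cats1 plen_cat /= addr0. Qed.

Lemma travelled_plen G u p : travelled G u p = plen G u (unzip2 p).
Proof. by elim: p u => [|[d v] p IH] u //=; rewrite IH. Qed.

Lemma last_rev_belast u w : last (last u w) (rev (belast u w)) = u.
Proof. by case: w => [|v w] //=; rewrite rev_cons last_rcons. Qed.

Definition shortest G s w : Prop := forall q,
  path (adj G) s q -> last s q = last s w -> plen G s w <= plen G s q.

Section PositiveLengths.
Variable G : adjmap R.
Hypothesis gG : is_graph G.

Lemma adj_sym u v : adj G u v = adj G v u.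
Proof. by case: gG => _ e _ _; rewrite /adj e. Qed.

Lemma len_sym u v : len G u v = len G v u.
Proof. by case: gG => _ e _ _; rewrite /len e. Qed.

Lemma len_gt0 u v : adj G u v -> 0 < len G u v.
Proof. by case: gG => _ _ + _; apply. Qed.

Lemma adj_domf u v : adj G u v -> u \in domf G.
Proof. by rewrite /adj /edge_len; case: fndP. Qed.

Lemma path_domf u w : u \in domf G -> path (adj G) u w -> last u w \in domf G.
Proof.
elim: w u => [|v w IH] u //= _ /andP[uv vw]; apply: IH vw.
by move: uv; rewrite adj_sym; apply: adj_domf.
Qed.

Lemma plen_ge0 u w : path (adj G) u w -> 0 <= plen G u w.
Proof.
elim: w u => [|v w IH] u //= /andP[uv vw].
by rewrite addr_ge0 ?IH// ltW// len_gt0.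
Qed.

Lemma plen_gt0 u w : path (adj G) u w -> w != [::] -> 0 < plen G u w.
Proof.
case: w => [|v w] //= /andP[uv vw] _.
by rewrite ltr_pwDl ?len_gt0 ?plen_ge0.
Qed.

Lemma path_rev_belast u w :
  path (adj G) u w -> path (adj G) (last u w) (rev (belast u w)).
Proof.
by rewrite rev_path; apply: sub_path => x y; rewrite /= adj_sym.
Qed.

Lemma plen_rev_belast u w :
  plen G (last u w) (rev (belast u w)) = plen G u w.
Proof.
elim: w u => [|v w IH] u //=.
by rewrite rev_cons plen_rcons IH last_rev_belast len_sym addrC.
Qed.

(* A shortest walk towards [v] bounds the outward leg, and the reverse of any
   walk back from [v], of a round trip through [v]. *)
Lemma round_trip s w q : shortest G s w -> path (adj G) s q -> last s q = s ->
  last s w \in s :: q -> plen G s w *+ 2 <= plen G s q.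
Proof.
move=> sw sq qs; rewrite inE => /orP[/eqP wq|].
  have := sw [::] isT; rewrite wq => /(_ erefl) /= w0.
  by apply: le_trans (plen_ge0 sq); rewrite mulr2n; lra.
move=> /splitPr eq; case: eq sq qs => q1 q2.
rewrite -cat_rcons cat_path last_cat last_rcons => /andP[p1 p2] qs.
rewrite plen_cat last_rcons mulr2n; apply: lerD.
  by apply: sw; rewrite ?last_rcons.
move/path_rev_belast: (p2); rewrite qs => p3.
rewrite -[plen G _ q2]plen_rev_belast qs; apply: sw => //.
by rewrite -[s in last s _]qs last_rev_belast.
Qed.

End PositiveLengths.

(** * Concatenation of itineraries *)

Lemma stops_nodes G t u p : unzip2 (stops G t u p) = u :: unzip2 p.
Proof. by elim: p t u => [|[d v] p IH] t u //=; rewrite IH. Qed.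

Definition arrival G t u p : R * nat := last (t, u) (stops G t u p).

Lemma last_stops x G t u p : last x (stops G t u p) = arrival G t u p.
Proof. by rewrite /arrival; case: p => [|[d v] p]. Qed.

Lemma arrival_cons G t u d v p :
  arrival G t u ((d, v) :: p) = arrival G (d + len G u v) v p.
Proof. by rewrite {1}/arrival /= last_stops. Qed.

Lemma arrival_node G t u p : (arrival G t u p).2 = last u (unzip2 p).
Proof.
by elim: p t u => [|[d v] p IH] t u //; rewrite arrival_cons IH.
Qed.

Lemma stops_cat G t u p1 p2 : stops G t u (p1 ++ p2) = stops G t u p1 ++
  behead (stops G (arrival G t u p1).1 (arrival G t u p1).2 p2).
Proof.
elim: p1 t u => [|[d v] p1 IH] t u; first by rewrite /=; case: p2 => [|[]].
by rewrite arrival_cons /= IH.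
Qed.

Lemma arrival_cat G t u p1 p2 : arrival G t u (p1 ++ p2) =
  arrival G (arrival G t u p1).1 (arrival G t u p1).2 p2.
Proof.
elim: p1 t u => [|[d v] p1 IH] t u; first by [].
by rewrite /= !arrival_cons IH.
Qed.

Lemma feasible_cat G t u p1 p2 : feasible G t u (p1 ++ p2) <->
  feasible G t u p1 /\
  feasible G (arrival G t u p1).1 (arrival G t u p1).2 p2.
Proof.
elim: p1 t u => [|[d v] p1 IH] t u; first by split=> [|[]].
rewrite arrival_cons /=; split=> [[td uv /IH[f1 f2]]|[[td uv f1] f2]] //.
by split=> //; apply/IH.
Qed.

Lemma feasible_path G t u p : feasible G t u p -> path (adj G) u (unzip2 p).
Proof. by elim: p t u => [|[d v] p IH] t u //= [_ -> /IH]. Qed.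

Lemma feasible_le G t t' u p : t' <= t -> feasible G t u p -> feasible G t' u p.
Proof.
by case: p => [|[d v] p] //= tt' [td ? ?]; split=> //; apply: le_trans td.
Qed.

Fixpoint legs G t u w : itinerary R :=
  if w is v :: w' then (t, v) :: legs G (t + len G u v) v w' else [::].

Lemma unzip2_legs G t u w : unzip2 (legs G t u w) = w.
Proof. by elim: w t u => [|v w IH] t u //=; rewrite IH. Qed.

Lemma arrival_legs G t u w :
  arrival G t u (legs G t u w) = (t + plen G u w, last u w).
Proof.
elim: w t u => [|v w IH] t u; first by rewrite /= addr0.
by rewrite arrival_cons IH addrA.
Qed.

Lemma feasible_legs G t u w : path (adj G) u w -> feasible G t u (legs G t u w).
Proof. by elim: w t u => [|v w IH] t u //= /andP[uv /IH]. Qed.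

Lemma legs_rcons G t u w v : legs G t u (rcons w v) =
  rcons (legs G t u w) (t + plen G u w, v).
Proof. by elim: w t u => [|v' w IH] t u /=; rewrite ?addr0 // IH addrA. Qed.

(** * Times of moves and arrivals; determinism of runs *)

Section Times.
Variable G : adjmap R.
Hypothesis gG : is_graph G.

Lemma feasible_arrival t u p :
  feasible G t u p -> t + travelled G u p <= (arrival G t u p).1.
Proof.
elim: p t u => [|[d v] p IH] t u; first by rewrite /= addr0.
rewrite arrival_cons /= => -[td uv /IH]; apply: le_trans.
by rewrite addrA lerD2r lerD2r.
Qed.

Lemma feasible_ge t u p m : feasible G t u p -> m \in p -> t <= m.1.
Proof.
elim: p t u => [|[d v] p IH] t u //= [td uv f].
rewrite inE => /orP[/eqP->//|/(IH _ _ f)]; apply: le_trans.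
by apply: le_trans td _; rewrite lerDl ltW// len_gt0.
Qed.

Lemma stops_ge t u p a : feasible G t u p -> a \in stops G t u p -> t <= a.1.
Proof.
elim: p t u => [|[d v] p IH] t u /=; first by rewrite inE => _ /eqP->.
move=> [td uv f]; rewrite inE => /orP[/eqP->//|/(IH _ _ f)]; apply: le_trans.
by apply: le_trans td _; rewrite lerDl ltW// len_gt0.
Qed.

Lemma stops_le t u p a : feasible G t u p -> a \in stops G t u p ->
  a.1 <= (arrival G t u p).1.
Proof.
elim: p t u => [|[d v] p IH] t u; first by rewrite /= inE => _ /eqP->.
move=> /[dup] f0; rewrite arrival_cons /= => -[td uv f].
rewrite inE => /orP[/eqP->/=|/(IH _ _ f)//].
have := feasible_arrival f0; rewrite arrival_cons; apply: le_trans.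
by rewrite travelled_plen lerDl (plen_ge0 gG)// (feasible_path f0).
Qed.

Lemma feasible_lt_arrival t u p m : feasible G t u p -> m \in p ->
  m.1 < (arrival G t u p).1.
Proof.
elim: p t u => [|[d v] p IH] t u //; rewrite arrival_cons /= => -[td uv f].
rewrite inE => /orP[/eqP->/=|/(IH _ _ f)//].
apply: lt_le_trans (feasible_arrival f).
rewrite -addrA ltrDl ltr_pwDl ?len_gt0// travelled_plen plen_ge0//.
exact: feasible_path f.
Qed.

Lemma feasible_sorted t u p : feasible G t u p ->
  sorted (fun a b : R * nat => a.1 < b.1) p.
Proof.
elim: p t u => [|[d v] p IH] t u //= [td uv f].
have {}IH := IH _ _ f; rewrite path_sortedE; last first.
  by move=> ? ? ?; apply: lt_trans.
rewrite IH andbT; apply/allP => m mp /=.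
by apply: lt_le_trans (feasible_ge f mp); rewrite ltrDl len_gt0.
Qed.

(** Departure times strictly increase, because every edge has positive length. *)
Lemma feasible_inj t u p d v v' : feasible G t u p ->
  (d, v) \in p -> (d, v') \in p -> v = v'.
Proof.
elim: p t u => [|[d0 v0] p IH] t u //= [td uv f].
have lt m : m \in p -> d0 < m.1.
  by move=> mp; apply: lt_le_trans (feasible_ge f mp); rewrite ltrDl len_gt0.
rewrite !inE => /orP[/eqP e1|vp] /orP[/eqP e2|v'p].
- by case: e1 e2 => _ -> [_ ->].
- by case: e1 v'p => -> _ v'p; have := lt _ v'p; rewrite /= ltxx.
- by case: e2 vp => -> _ vp; have := lt _ vp; rewrite /= ltxx.
- exact: IH f vp v'p.
Qed.

Lemma moves_before_nil t u p t' : feasible G t u p -> t' <= t ->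
  moves_before t' p = [::].
Proof.
move=> f tt'; apply/eqP; rewrite -[_ == _]negbK -has_filter; apply/hasPn => m mp.
by rewrite -leNgt (le_trans tt')// (feasible_ge f mp).
Qed.

Lemma moves_before_cat t u p1 p2 t' : feasible G t u p2 -> t' <= t ->
  moves_before t' (p1 ++ p2) = moves_before t' p1.
Proof.
move=> f tt'; have := moves_before_nil f tt'.
by rewrite /moves_before filter_cat => ->; rewrite cats0.
Qed.

Lemma moves_before_all t u p t' : feasible G t u p ->
  (arrival G t u p).1 <= t' -> moves_before t' p = p.
Proof.
move=> f tt'; apply/all_filterP/allP => m mp.
exact: lt_le_trans (feasible_lt_arrival f mp) tt'.
Qed.

(** A move departing at time [t] or later ends strictly after [t], so what is known at [t] depends
    on earlier moves only. *)
Lemma stops_moves_before t0 u p t : feasible G t0 u p ->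
  [seq a <- stops G t0 u p | a.1 <= t] =
  [seq a <- stops G t0 u (moves_before t p) | a.1 <= t].
Proof.
elim: p t0 u => [|[d v] p IH] t0 u //= [td uv f].
have [dt|dt] := ltP d t; first by rewrite /= IH.
rewrite -/(moves_before t p) (moves_before_nil f) /=; last first.
  by apply: le_trans dt _; rewrite lerDl ltW// len_gt0.
case: ifP => _; [congr cons|];
  apply/eqP; rewrite -[_ == _]negbK -has_filter; apply/hasPn => a ap;
  rewrite -ltNge (lt_le_trans _ (stops_ge f ap))//;
  by apply: le_lt_trans dt _; rewrite ltrDl len_gt0.
Qed.

Lemma visited_moves_before s k (S : schedule R k) t :
  (forall i, feasible G 0 s (S i)) ->
  visited G s S t = visited G s (fun i => moves_before t (S i)) t.
Proof.
move=> f; rewrite /visited; under eq_map do rewrite (stops_moves_before _ (f _)).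
by [].
Qed.

Lemma visitedP s k (S : schedule R k) t v :
  reflect (exists i a, [/\ (a, v) \in stops G 0 s (S i) & a <= t])
          (v \in visited G s S t).
Proof.
rewrite /visited in_fset /=; apply: (iffP flattenP) => [[l]|[i [a [ai at_]]]].
  move=> /mapP[i _ ->] /mapP[[a v'] ]; rewrite mem_filter /= => /andP[at_ ai] ->.
  by exists i, a.
exists [seq a.2 | a <- stops G 0 s (S i) & a.1 <= t].
  by apply/mapP; exists i; rewrite ?mem_enum.
by apply/mapP; exists (a, v); rewrite ?mem_filter ?at_.
Qed.

Lemma node_at_moves_before s p t :
  node_at G s p t = node_at G s (moves_before t p) t.
Proof. by rewrite /node_at /moves_before filter_id. Qed.

(** A move departs only after the previous one has ended; hence the condition on [node_at] in [run]
    holds at every departure. *)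
Lemma node_at_move s p d v : feasible G 0 s p -> (d, v) \in p ->
  node_at G s p d <> None.
Proof.
move=> f dp; rewrite /node_at last_stops.
suff -> : (arrival G 0 s (moves_before d p)).1 <= d by [].
elim: p (0 : R) s f dp => [|[d0 v0] p IH] t u //= [td uv f].
rewrite inE => /orP[/eqP[-> _]|dp].
  by rewrite ltxx -/(moves_before d0 p) (moves_before_nil f)// lerDl ltW// len_gt0.
have -> : d0 < d.
  by apply: lt_le_trans (feasible_ge f dp); rewrite ltrDl len_gt0.
by rewrite arrival_cons; apply: IH.
Qed.

(** At the departure time [d] of a move of [S], equal histories give equal positions and equal
    knowledge, hence the same command in both runs. *)
Lemma run_sub k (sigma : strategy R k) s S T S' T' t :
  run sigma G s S T -> run sigma G s S' T' -> t <= T -> t <= T' ->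
  (forall d i, d < t -> (exists j m, m \in S j /\ m.1 = d) ->
    moves_before d (S i) = moves_before d (S' i)) ->
  forall i, {subset moves_before t (S i) <= moves_before t (S' i)}.
Proof.
move=> [[f _ _ _] r] [[f' _ _ _] r'] tT tT' IH i [d v].
rewrite !mem_filter /= => /andP[dt di]; rewrite dt /=.
have {}IH j : moves_before d (S j) = moves_before d (S' j).
  by apply: IH => //; exists i, (d, v).
have n : node_at G s (S i) d <> None by exact: node_at_move (f i) di.
have n' : node_at G s (S' i) d <> None.
  by rewrite node_at_moves_before -IH -node_at_moves_before.
apply/(r' d i (lt_le_trans dt tT') n').
have eqS : (fun j => moves_before d (S j)) = (fun j => moves_before d (S' j)).
  by apply/funext => j.
have <- : knowledge G s S d = knowledge G s S' d.
  rewrite /knowledge (visited_moves_before d f) (visited_moves_before d f').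
  by rewrite eqS.
rewrite -eqS.
by apply/(r d i (lt_le_trans dt tT) n).
Qed.

(** Time is real, so the induction is on the number of moves that both runs together make before
    [t]. *)
Lemma run_agree k (sigma : strategy R k) s S T S' T' t :
  run sigma G s S T -> run sigma G s S' T' -> t <= T -> t <= T' ->
  forall i, moves_before t (S i) = moves_before t (S' i).
Proof.
move=> rS rS'.
pose ms := flatten [seq S i ++ S' i | i <- enum 'I_k].
have [n] := ubnP (count (fun m => m.1 < t) ms).
elim: n t => // n IH t; rewrite ltnS => nt tT tT'.
have agree d i j m : d < t -> m \in S j ++ S' j -> m.1 = d ->
    moves_before d (S i) = moves_before d (S' i).
  move=> dt mj md; apply: IH; rewrite ?(le_trans (ltW dt))//.
  apply: leq_trans nt; rewrite -!size_filter.
  have -> : [seq x <- ms | x.1 < d] =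
            [seq x <- [seq x <- ms | x.1 < t] | x.1 < d].
    rewrite -filter_predI; apply: eq_filter => x /=.
    by case: ltP => //= xd; rewrite (lt_trans xd dt).
  (* The count drops strictly: [m] departs at [d] itself, so it lies before [t] but not before
     [d]. *)
  rewrite size_filter ltn_neqAle count_size andbT -all_count.
  apply/allPn; exists m; last by rewrite md ltxx.
  rewrite mem_filter md dt; apply/flattenP; exists (S j ++ S' j) => //.
  by apply: map_f; rewrite mem_enum.
move=> i; have [[f _ _ _] _] := rS; have [[f' _ _ _] _] := rS'.
(* A list strictly sorted by time is determined by its members, so two inclusions suffice. *)
have tr : transitive (fun a b : R * nat => a.1 < b.1).
  by move=> ? ? ?; apply: lt_trans.
apply: (irr_sorted_eq tr); first by move=> ?; rewrite /= ltxx.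
- by apply: sorted_filter => //; apply: feasible_sorted (f i).
- by apply: sorted_filter => //; apply: feasible_sorted (f' i).
move=> m; apply/idP/idP; [apply: (run_sub rS rS') | apply: (run_sub rS' rS)] => //.
  move=> d j dt [l [m' [ml md]]]; apply: (agree d j l m') => //.
  by rewrite mem_cat ml.
move=> d j dt [l [m' [ml md]]]; apply/esym/(agree d j l m') => //.
by rewrite mem_cat ml orbT.
Qed.

(** If [T < T'], the second run agrees with the first up to [T] and is thus already finished at [T],
    against the minimality of [T']. *)
Lemma run_finish_le k (sigma : strategy R k) s S T S' T' :
  run sigma G s S T -> run sigma G s S' T' -> T <= T' -> T = T'.
Proof.
move=> /[dup] rS [[f _ [dV nT] _] _] /[dup] rS' [[f' _ _ min'] _] TT'.
apply/eqP; rewrite eq_le TT' leNgt; apply/negP => lt.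
have ag := run_agree rS rS' (lexx _) TT'.
apply: (min' T) => //; split=> [|i]; last first.
  by rewrite node_at_moves_before -ag -node_at_moves_before.
rewrite visited_moves_before//.
have <- : (fun j => moves_before T (S j)) = (fun j => moves_before T (S' j)).
  by apply/funext => j.
by rewrite -visited_moves_before.
Qed.

(** The ratios range over all runs; uniqueness reduces them to the one run constructed below. *)
Lemma run_unique k (sigma : strategy R k) s S T S' T' :
  run sigma G s S T -> run sigma G s S' T' -> T = T' /\ S = S'.
Proof.
move=> rS rS'; have TT : T = T'.
  have [|/ltW] := leP T T' => TT; first exact: run_finish_le rS rS' TT.
  exact/esym/(run_finish_le rS' rS TT).
split=> //; subst T'; apply/funext => i.
have := run_agree rS rS' (lexx _) (lexx _) i.
case: rS rS' => [[_ b _ _] _] [[_ b' _ _] _].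
have -> : moves_before T (S i) = S i by apply/all_filterP/allP => m; exact: b.
by have -> : moves_before T (S' i) = S' i by apply/all_filterP/allP => m; exact: b'.
Qed.

End Times.
End Walks.

(** * Degrees, the optimum, and a tight example *)

Section Degrees.
Local Open Scope nat_scope.

Lemma mem_zip_nth (s1 s2 : seq nat) u v : uniq s1 -> size s1 = size s2 ->
  (u, v) \in zip s1 s2 -> u \in s1 /\ v = nth 0 s2 (index u s1).
Proof.
move=> u1 eq12 /(nthP (0, 0))[i].
rewrite size_zip -eq12 minnn => lti; rewrite nth_zip// => -[<- <-].
by rewrite mem_nth// index_uniq.
Qed.

(** Successor and predecessor of [u] on the walk [x :: t], each where it exists. The walk may be
    closed, with [x] at both ends. *)
Definition path_nbrs x (t : seq nat) u : seq nat :=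
  nseq (u \in belast x t) (nth 0 t (index u (belast x t))) ++
  nseq (u \in t) (nth 0 (belast x t) (index u t)).

Lemma consecutive_nbrs x t u v : uniq (belast x t) -> uniq t ->
  consecutive (x :: t) u v -> v \in path_nbrs x t u.
Proof.
move=> ub ut; rewrite /consecutive.
have -> : zip (x :: t) (behead (x :: t)) = zip (belast x t) t.
  by rewrite /=; elim: t x {ub ut} => //= y t IH x; rewrite IH.
have sz : size (belast x t) = size t by rewrite size_belast.
rewrite mem_cat => /orP[/(mem_zip_nth ub sz)[-> ->]|uv].
  by rewrite mem_seq1 eqxx.
have [|-> ->] := @mem_zip_nth t (belast x t) u v ut (esym sz).
  move: uv; rewrite -[zip t _]/(zip _ _) => uv.
  have -> : zip t (belast x t) = [seq (a.2, a.1) | a <- zip (belast x t) t].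
    elim: t x {ub ut sz uv} => //= y t IH x; rewrite IH.
    by [].
  by apply/mapP; exists (v, u).
by rewrite mem_seq1 eqxx orbT.
Qed.

Definition degree_le_2_except (R : realType) (G : adjmap R) x :=
  forall u (L : seq nat), uniq L -> all (adj G u) L -> size L <= 2 + (u == x).

(** The cycle gives each of its nodes two neighbours; the tail gives [x] one more, and at most two
    to its other nodes, which are not on the cycle. *)
Lemma tadpole_degree (R : realType) (G : adjmap R) :
  tadpole G -> exists x, degree_le_2_except G x.
Proof.
move=> [x [c [t [unx sc st dom adjE]]]]; exists x => u L uL /allP aL.
pose N := path_nbrs x (rcons c x) u ++ path_nbrs x t u.
move: unx; rewrite cons_uniq mem_cat cat_uniq negb_or.
move=> /andP[/andP[xc xt] /and3P[uc ct ut]].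
have ub : uniq (belast x (rcons c x)) by rewrite belast_rcons /= xc uc.
have ur : uniq (rcons c x) by rewrite rcons_uniq xc uc.
have ubt : uniq (belast x t).
  have : uniq (x :: t) by rewrite /= xt ut.
  by rewrite lastI rcons_uniq => /andP[].
have LN : {subset L <= N}.
  move=> v /aL; rewrite adjE mem_cat => /orP[] /consecutive_nbrs -> //.
  by rewrite orbT.
apply: leq_trans (uniq_leq_size uL LN) _.
rewrite !size_cat !size_nseq belast_rcons mem_rcons !inE.
have := @mem_belast _ t x u; rewrite inE.
have [-> _|ux] := eqVneq u x; first by rewrite (negbTE xt) (negbTE xc); lia.
have := hasPn ct u; case: (u \in t) => [/(_ isT) /negbTE ->|_ /= h].
  by case: (u \in belast x t).
by case: (u \in belast x t) h => [/(_ isT)|_] //; case: (u \in c).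
Qed.

End Degrees.

(** * Bounds on the optimum *)

Section Optimum.
Variables (R : realType) (G : adjmap R).
Hypothesis gG : is_graph G.

(** Some agent visits the end of [w] and is back at [s] in the end; the distance it travels is at
    most the cost in either model. *)
Lemma cost_ge m s k (S : schedule R k) T w : exploration G s S T ->
  path (adj G) s w -> shortest G s w -> last s w \in domf G ->
  plen G s w *+ 2 <= cost m G s S T.
Proof.
move=> [f b [dV nT] _] pw sw wG.
have /visitedP[i [a [ai aT]]] : last s w \in visited G s S T.
  exact: (fsubsetP dV).
have mb : moves_before T (S i) = S i by apply/all_filterP/allP => m'; exact: b.
have := nT i; rewrite /node_at mb last_stops; case: ifP => // le [ar].
have wS : plen G s w *+ 2 <= travelled G s (S i).
  rewrite travelled_plen; apply: round_trip => //; first exact: feasible_path (f i).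
    by rewrite -(arrival_node G 0).
  by rewrite -(stops_nodes G 0); apply/mapP; exists (a, last s w).
apply: le_trans wS _; case: m => /=.
  by apply: le_trans le; have := feasible_arrival (f i); rewrite add0r.
exact: (le_bigmax _ (fun i => travelled G s (S i))).
Qed.

Lemma opt_ge m s k (S : schedule R k) T w : exploration G s S T ->
  path (adj G) s w -> shortest G s w -> last s w \in domf G ->
  plen G s w *+ 2 <= opt m G s k.
Proof.
(* The given exploration makes the set of costs nonempty. *)
move=> eS pw sw wG; apply: lb_le_inf; first by exists (cost m G s S T), S, T.
by move=> _ [S' [T' [eS' ->]]]; apply: cost_ge eS' _ _ _.
Qed.

Lemma opt_le m s k (S : schedule R k) T : s \in domf G -> exploration G s S T ->
  opt m G s k <= cost m G s S T.
Proof.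
move=> sG eS; apply: ge_inf; last by exists S, T.
exists 0 => _ [S' [T' [eS' ->]]].
(* For the empty walk the lower bound on costs is 0. *)
rewrite -(mul0rn R 2); apply: (cost_ge (w := [::]) m eS') => //.
by move=> q pq _; apply: plen_ge0.
Qed.

End Optimum.

(** * A tadpole on which the time ratio 2 is attained *)

Section Example.
Variable R : realType.

(** The triangle 0, 1, 2 with a pendant edge from 0 to 3. Node 0 is adjacent to the three others, so
    three agents can explore it in time 2. *)
Definition unit_tadpole : adjmap R :=
  [fmap].[0%N <- [fmap].[1%N <- 1].[2%N <- 1].[3%N <- 1]]
        .[1%N <- [fmap].[0%N <- 1].[2%N <- 1]]
        .[2%N <- [fmap].[0%N <- 1].[1%N <- 1]]
        .[3%N <- [fmap].[0%N <- 1]].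

Definition unit_tadpole_edges : seq (nat * nat) :=
  [:: (0, 1); (0, 2); (0, 3); (1, 0); (1, 2); (2, 0); (2, 1); (3, 0)]%N.

Lemma edge_len_unit u v : edge_len unit_tadpole u v =
  if (u, v) \in unit_tadpole_edges then Some 1 else None.
Proof.
rewrite /edge_len /unit_tadpole !fnd_set.
by case: u => [|[|[|[|u]]]] /=; rewrite ?fnd_set ?fnd_fmap0//;
   case: v => [|[|[|[|v]]]].
Qed.

Lemma adj_unit u v : adj unit_tadpole u v = ((u, v) \in unit_tadpole_edges).
Proof. by rewrite /adj edge_len_unit; case: ifP. Qed.

Lemma domf_unit : domf unit_tadpole =i [:: 0; 1; 2; 3]%N.
Proof.
move=> u; rewrite -fndSome /unit_tadpole !fnd_set.
by case: u => [|[|[|[|u]]]] //=; rewrite fnd_fmap0.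
Qed.

Lemma len_unit u v : adj unit_tadpole u v -> len unit_tadpole u v = 1.
Proof. by rewrite adj_unit /len edge_len_unit => ->. Qed.

Lemma unit_tadpole_graph : is_graph unit_tadpole.
Proof.
split=> [u|u v|u v uv|u v].
- by rewrite adj_unit; case: u => [|[|[|[|u]]]].
- by rewrite !edge_len_unit; case: u => [|[|[|[|u]]]]; case: v => [|[|[|[|v]]]].
- by rewrite len_unit.
rewrite !domf_unit => us vs.
(* Every two nodes are joined through node 0. *)
exists (nseq (u != 0%N) 0%N ++ nseq (v != 0%N) v).
  move: us vs; rewrite !inE.
  move=> /or4P[]/eqP-> /or4P[]/eqP-> //=; by rewrite !adj_unit.
by move: us vs; rewrite !inE => /or4P[]/eqP-> /or4P[]/eqP->.
Qed.

Lemma unit_tadpole_tadpole : tadpole unit_tadpole.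
Proof.
exists 0%N, [:: 1; 2]%N, [:: 3]%N; split=> // [|u v]; first exact: domf_unit.
rewrite adj_unit /consecutive /=.
by case: u => [|[|[|[|u]]]]; case: v => [|[|[|[|v]]]].
Qed.

Definition unit_schedule : schedule R 3 := fun i => [:: (0, i.+1); (1, 0%N)].

Lemma unit_exploration : exploration unit_tadpole 0 unit_schedule 2.
Proof.
have a0 (i : 'I_3) : adj unit_tadpole 0 i.+1.
  by rewrite adj_unit; case: i => [[|[|[|]]]].
have a1 (i : 'I_3) : adj unit_tadpole i.+1 0.
  by rewrite (adj_sym unit_tadpole_graph).
split=> [i|i m|| t t2 [dV nT]].
- by rewrite /= a0 a1 len_unit// add0r.
- by rewrite !inE => /orP[]/eqP-> /=; lra.
- split=> [|i]; last first.
    rewrite /node_at /moves_before /=.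
    have -> : (0 < 2 :> R) by lra.
    have -> : (1 < 2 :> R) by lra.
    by rewrite /= len_unit// ifT//; lra.
  apply/fsubsetP => v; rewrite domf_unit => v4.
  apply/visitedP.
  move: v4; rewrite inE => /orP[/eqP->|v3].
    by exists ord0, 0; rewrite inE eqxx; split => //; lra.
  have lv : (v.-1 < 3)%N by move: v3; rewrite !inE => /or3P[]/eqP->.
  exists (Ordinal lv), 1; rewrite /= len_unit; last exact: (a0 (Ordinal lv)).
  rewrite add0r prednK ?inE ?eqxx ?orbT; first by split=> //; lra.
  by move: v3; rewrite !inE => /or3P[]/eqP->.
(* Between times 0 and 2, agent 0 is inside an edge or at node 1; for [t <= 0], node 1 is still
   unvisited. *)
have := nT ord0; rewrite /node_at /moves_before /=.
have [t0|t0] := ltP 0 t; have [t1|t1] := ltP 1 t => //=.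
- by rewrite !len_unit// ?(a0 ord0) ?(a1 ord0)// ifN// -ltNge; lra.
- by rewrite len_unit ?(a0 ord0)//; case: ifP.
- by exfalso; lra.
move=> _; have /visitedP[i [a]] : 1%N \in visited unit_tadpole 0 unit_schedule t.
  by apply: (fsubsetP dV); rewrite domf_unit.
rewrite /= !inE !len_unit// => -[/or3P[]/eqP[]// -> _ a_t]; lra.
Qed.

Lemma opt_unit : opt Time unit_tadpole 0 3 <= 2.
Proof.
apply: (opt_le unit_tadpole_graph Time _ unit_exploration).
by rewrite domf_unit.
Qed.

End Example.

(** * Shortest-path trees *)

(* A shortest-path tree rooted at [s] is a list of pairs [(w, v)]: the walk [w]
   from [s] to the parent of [v], and the node [v]; latest node first. *)
Definition tree := seq (seq nat * nat).

Definition walks (T : tree) : seq (seq nat) :=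
  [::] :: [seq rcons e.1 e.2 | e <- T].

Definition seen (s : nat) (T : tree) : {fset nat} := [fset v in s :: unzip2 T].

Definition children (s : nat) (T : tree) (u : nat) : nat :=
  count (fun e => last s e.1 == u) T.
Arguments children : simpl never.

Section Trees.
Variable R : realType.
Implicit Types (G K : adjmap R) (T : tree) (s u v : nat) (w : seq nat).

Definition nbrs K u : seq nat :=
  if K.[? u] is Some N then enum_fset (domf N) else [::].

Definition frontier K s T : tree :=
  [seq (w, v) | w <- walks T,
                v <- [seq v <- nbrs K (last s w) | v \notin seen s T]].

(** The choice made by Dijkstra's algorithm; ties are resolved by the sort, so it is a function of
    what is known. *)
Definition nearest K s (l : tree) : option (seq nat * nat) :=
  ohead (sort (relpre (fun e => plen K s (rcons e.1 e.2)) <=%R) l).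

Lemma mem_nbrs K u v : (v \in nbrs K u) = adj K u v.
Proof.
rewrite /nbrs /adj /edge_len; case: (K.[? u]) => [N|] //.
by rewrite fndSome.
Qed.

Lemma mem_frontier K s T w v : ((w, v) \in frontier K s T) =
  [&& w \in walks T, v \notin seen s T & adj K (last s w) v].
Proof.
apply/allpairsPdep/and3P => [[w' [v' [wT + [-> ->]]]]|[wT vT wv]].
  by rewrite mem_filter mem_nbrs => /andP[].
by exists w, v; rewrite mem_filter mem_nbrs vT wT wv.
Qed.

Lemma nearestP K s (l : tree) :
  match nearest K s l with
  | Some e => e \in l /\
      forall f, f \in l -> plen K s (rcons e.1 e.2) <= plen K s (rcons f.1 f.2)
  | None => l = [::]
  end.
Proof.
rewrite /nearest; set r := relpre _ _.
have tot : total r by move=> a b; apply: le_total.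
have tr : transitive r by move=> a b c; apply: le_trans.
have := sort_sorted tot l; have /perm_mem := permEl (perm_sort r l).
case: (sort r l) (size_sort r l) => [|e l'] /=.
  by move=> /esym/size0nil ->.
move=> _ mem /(order_path_min tr)/allP min; split=> [|f].
  by rewrite -mem mem_head.
by rewrite -mem inE => /orP[/eqP->//|]; apply: min.
Qed.

Lemma mem_seen s T v : (v \in seen s T) = (v \in s :: unzip2 T).
Proof. by rewrite in_fset. Qed.

Lemma seen_cons s T w v : seen s ((w, v) :: T) = v |` seen s T.
Proof.
by apply/fsetP => u; rewrite in_fset1U !mem_seen !inE orbCA.
Qed.

Lemma mem_walks_cons T w v w' :
  (w' \in walks ((w, v) :: T)) = (w' == rcons w v) || (w' \in walks T).
Proof. by rewrite /walks !inE orbCA. Qed.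

Lemma mem_walks T e : e \in T -> rcons e.1 e.2 \in walks T.
Proof.
by move=> eT; rewrite inE; apply/orP; right; apply/mapP; exists e.
Qed.

(** A node of the tree is identified with the walk leading to it, which is sound by [tree_inj]. *)
Record shortest_tree G s T : Prop := ShortestTree {
  tree_uniq : uniq (s :: unzip2 T);
  tree_path : {in walks T, forall w, path (adj G) s w};
  tree_shortest : {in walks T, forall w, shortest G s w};
  tree_uniq_walk : {in walks T, forall w, uniq (s :: w)};
  tree_seen : {in walks T, forall w, {subset s :: w <= seen s T}};
  tree_parent : forall e, e \in T -> e.1 \in walks T;
  tree_inj : {in walks T &, injective (last s)} }.

Section ShortestTree.
Variables (G : adjmap R) (s : nat).
Hypothesis gG : is_graph G.
Hypothesis sG : s \in domf G.

Lemma shortest_tree_nil : shortest_tree G s [::].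
Proof.
split=> // [w|w|w|w|w w']; rewrite ?inE => /eqP-> //.
- by move=> q pq _; apply: plen_ge0.
- by move=> v; rewrite mem_seen.
- by move=> /eqP->.
Qed.

Lemma seen_walk T v : v \in seen s T -> exists2 w, w \in walks T & last s w = v.
Proof.
rewrite mem_seen inE => /orP[/eqP->|/mapP[e eT ->]].
  by exists [::].
exists (rcons e.1 e.2); last by rewrite last_rcons.
exact: mem_walks.
Qed.

Lemma last_seen T w : shortest_tree G s T -> w \in walks T ->
  last s w \in seen s T.
Proof. by move=> tT wT; apply: (tree_seen tT wT); rewrite mem_last. Qed.

Lemma seen_domf T : shortest_tree G s T -> seen s T `<=` domf G.
Proof.
move=> tT; apply/fsubsetP => v /seen_walk[w wT <-].
by apply: path_domf => //; apply: tree_path wT.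
Qed.

(** Cut the walk at its first step out of [A]. *)
Lemma path_exit (A : {fset nat}) u w : u \in A -> path (adj G) u w ->
  last u w \notin A -> exists w1 v w2,
  [/\ w = w1 ++ v :: w2, last u w1 \in A & v \notin A].
Proof.
elim: w u => [|v w IH] u uA /=; first by rewrite uA.
move=> /andP[uv vw] lA; have [vA|vA] := boolP (v \in A); last by exists [::], v, w.
have [w1 [v' [w2 [-> ? ?]]]] := IH v vA vw lA.
by exists (v :: w1), v', w2.
Qed.

(** By connectedness, a walk to an unseen node would leave the seen set through an edge of the
    frontier. *)
Lemma seen_all T : shortest_tree G s T -> frontier G s T = [::] ->
  seen s T = domf G.
Proof.
move=> tT f0; apply/eqP; rewrite eqEfsubset seen_domf//=.
apply/fsubsetP => v vG; apply/negPn/negP => vT.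
have [_ _ _ /(_ s v sG vG) [q pq qv]] := gG.
have sT : s \in seen s T by rewrite mem_seen mem_head.
have [|q1 [b [q2 [qE q1T bT]]]] := path_exit sT pq; first by rewrite qv.
have [w wT wq1] := seen_walk q1T.
suff : (w, b) \in frontier G s T by rewrite f0.
rewrite mem_frontier wT bT wq1.
by move: pq; rewrite qE cat_path /= => /and3P[].
Qed.

Lemma frontier_all T : seen s T = domf G -> frontier G s T = [::].
Proof.
move=> all; case E: (frontier _ _ _) => [//|[w v] l].
have : (w, v) \in frontier G s T by rewrite E mem_head.
rewrite mem_frontier all (adj_sym gG) => /and3P[_ vG /adj_domf].
by rewrite (negbTE vG).
Qed.

(** This is the correctness of Dijkstra's algorithm: a competing walk to the new node must leave the
    seen set along a frontier edge. *)
Lemma shortest_tree_cons T w v : shortest_tree G s T ->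
  (w, v) \in frontier G s T ->
  (forall e, e \in frontier G s T ->
     plen G s (rcons w v) <= plen G s (rcons e.1 e.2)) ->
  shortest_tree G s ((w, v) :: T).
Proof.
move=> tT; rewrite mem_frontier => /and3P[wT vT wv] min.
have seenW : {subset seen s T <= seen s ((w, v) :: T)}.
  by move=> u uT; rewrite seen_cons in_fset1U uT orbT.
have [ut pt st uw sn pa inj] := tT.
split.
- move: vT ut; rewrite mem_seen /= !inE !negb_or [s == v]eq_sym.
  by move=> /andP[-> ->] /andP[-> ->].
- move=> w'; rewrite mem_walks_cons => /orP[/eqP->|/pt//].
  by rewrite rcons_path wv pt.
- move=> w'; rewrite mem_walks_cons => /orP[/eqP->|/st//].
  move=> q pq; rewrite last_rcons => qv.
  have sT : s \in seen s T by rewrite mem_seen mem_head.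
  have [|q1 [b [q2 [qE q1T bT]]]] := path_exit sT pq; first by rewrite qv.
  have [w1 w1T w1q1] := seen_walk q1T.
  move: pq; rewrite qE cat_path /= => /and3P[pq1 q1b pq2].
  have /min /= : (w1, b) \in frontier G s T.
    by rewrite mem_frontier w1T bT w1q1.
  move=> /le_trans; apply.
  (* Up to its exit [q] is no shorter than the tree walk [w1], and the rest of [q] has nonnegative
     length. *)
  rewrite plen_rcons plen_cat /= w1q1.
  have := st w1 w1T q1 pq1 (esym w1q1); have := plen_ge0 gG pq2; lra.
- move=> w'; rewrite mem_walks_cons => /orP[/eqP->|/uw//].
  rewrite -rcons_cons rcons_uniq uw// andbT.
  by apply: contra vT; apply: sn.
- move=> w'; rewrite mem_walks_cons => /orP[/eqP->|/sn w'T].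
    move=> u; rewrite -rcons_cons mem_rcons inE => /orP[/eqP->|/(sn _ wT)/seenW//].
    by rewrite seen_cons in_fset1U eqxx.
  by move=> u /w'T/seenW.
- move=> e; rewrite inE mem_walks_cons => /orP[/eqP->|/pa ->]; last by rewrite orbT.
  by rewrite /= wT orbT.
- move=> w1 w2; rewrite !mem_walks_cons => /orP[/eqP->|w1T] /orP[/eqP->|w2T] //.
  + rewrite last_rcons => vw2; move: vT.
    by rewrite vw2 last_seen.
  + rewrite last_rcons => vw1; move: vT.
    by rewrite -vw1 last_seen.
  + exact: inj.
Qed.

(** Children are distinct neighbours of [u], and a node other than [s] has its parent as one more
    neighbour; hence the subtraction. *)
Lemma children_degree x T u : shortest_tree G s T -> degree_le_2_except G x ->
  (children s T u <= 2 + (u == x) - (u != s))%N.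
Proof.
clear sG => tT dG; have [ut pt st uw sn pa inj] := tT.
pose L := [seq e.2 | e <- T & last s e.1 == u].
have sL : children s T u = size L by rewrite size_map size_filter.
have uL : uniq L.
  move: ut => /= /andP[_]; apply: subseq_uniq.
  exact: map_subseq (filter_subseq _ _).
have aL : all (adj G u) L.
  apply/allP => _ /mapP[e + ->]; rewrite mem_filter => /andP[/eqP<- eT].
  have : rcons e.1 e.2 \in walks T by exact: mem_walks.
  by move=> /pt; rewrite rcons_path => /andP[].
have [us|us] := eqVneq u s; first by rewrite subn0 sL; apply: dG.
have [uT|uT] := boolP (u \in seen s T); last first.
  rewrite /children (eq_in_count (a2 := pred0)) ?count_pred0// => e eT.
  by apply: contraNF uT => /eqP <-; apply: last_seen => //; apply: pa.
move: uT; rewrite mem_seen inE (negbTE us) => /mapP[e eT ue].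
have eW : rcons e.1 e.2 \in walks T by exact: mem_walks.
rewrite sL; suff /(dG u) : uniq (last s e.1 :: L).
  rewrite /= aL andbT => h.
  have : adj G u (last s e.1).
    rewrite ue (adj_sym gG); move/pt: eW; rewrite rcons_path => /andP[] //.
  by move=> /h /=; lia.
(* The parent is not among the children: the walk to such a child would visit it twice. *)
rewrite /= uL andbT; apply/negP => /mapP[f].
rewrite mem_filter => /andP[/eqP lf fT] fe.
have fW : rcons f.1 f.2 \in walks T by exact: mem_walks.
have : f.1 = rcons e.1 e.2 by apply: inj; rewrite ?pa// last_rcons lf.
move=> f1; move/uw: fW; rewrite f1 -fe -!rcons_cons !rcons_uniq.
by rewrite mem_rcons inE mem_last orbT.
Qed.

End ShortestTree.
End Trees.

(** * Steps of the exploration *)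

Section Restriction.
Variable R : realType.
Implicit Types (G : adjmap R) (A : {fset nat}) (u v : nat) (w : seq nat).

Lemma edge_len_restrict G A u v : u \in A ->
  edge_len G.[& A] u v = edge_len G u v.
Proof. by move=> uA; rewrite /edge_len fnd_restrict uA. Qed.

(** The end of the walk may lie outside [A], as each edge is looked up at the node where it
    starts. *)
Lemma plen_restrict G A u w : {subset belast u w <= A} ->
  plen G.[& A] u w = plen G u w.
Proof.
elim: w u => [|v w IH] u //= sub.
rewrite IH => [|x xw]; last by apply: sub; rewrite inE xw orbT.
by rewrite /len edge_len_restrict// sub// mem_head.
Qed.

Lemma legs_restrict G A t u w : {subset belast u w <= A} ->
  legs G.[& A] t u w = legs G t u w.
Proof.
elim: w t u => [|v w IH] t u //= sub.
rewrite IH => [|x xw]; last by apply: sub; rewrite inE xw orbT.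
by rewrite /len edge_len_restrict// sub// mem_head.
Qed.

End Restriction.

Section Steps.
Variable R : realType.
Implicit Types (G K : adjmap R) (s u v : nat) (w : seq nat).

(* [pos st i] is the walk from the start to the node of agent [i], all agents
   being at nodes. *)
Record state := State {
  clock : R;
  explored : tree;
  pos : 'I_3 -> seq nat;
  out : schedule R 3 }.

Definition start : state := State 0 [::] (fun=> [::]) (fun=> [::]).

Definition mover (st : state) w : 'I_3 :=
  odflt (odflt ord0 [pick i | pos st i == [::]]) [pick i | pos st i == w].

(** [r] is the rest of the way to [v]: one edge if the mover stands at the end of [w], the whole
    walk if it is still at [s]. *)
Definition advance K s st w v : state :=
  let i := mover st w in
  let u := last s (pos st i) in
  let r := rcons (drop (size (pos st i)) w) v in
  State (clock st + plen K u r) ((w, v) :: explored st)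
    (fun j => if j == i then rcons w v else pos st j)
    (fun j => if j == i then out st i ++ legs K (clock st) u r else out st j).

(* Restricting [K] to the nodes visited by the simulated agents makes the step
   independent of what they have not seen yet. *)
Definition step s K st : state :=
  let K' := K.[& seen s (explored st)] in
  if nearest K' s (frontier K' s (explored st)) is Some e
  then advance K' s st e.1 e.2 else st.

Variables (G : adjmap R) (s x : nat).
Hypothesis gG : is_graph G.
Hypothesis sG : s \in domf G.
Hypothesis dG : degree_le_2_except G x.

(* The bound on the number of agents that have left [s] reflects that a second
   agent is sent only towards [s] or [x], the possible branchings. *)
Record coherent (st : state) : Prop := Coherent {
  inv_tree : shortest_tree G s (explored st);
  inv_pos : forall i, pos st i \in walks (explored st);
  inv_feasible : forall i, feasible G 0 s (out st i);
  inv_out : forall i, unzip2 (out st i) = pos st i;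
  inv_arrival : forall i, (arrival G 0 s (out st i)).1 <= clock st;
  inv_clock : clock st = \sum_i plen G s (pos st i);
  inv_active : (#|[pred i | pos st i != [::]]| <= children s (explored st) s +
    if s == x then 0 else (children s (explored st) x).-1)%N;
  inv_leaf : forall w, w \in walks (explored st) -> w != [::] ->
    (exists i, pos st i = w) \/ (0 < children s (explored st) (last s w))%N;
  inv_seen : forall v, v \in seen s (explored st) ->
    exists i, v \in s :: pos st i }.

Lemma coherent_start : coherent start.
Proof.
split=> //=.
- exact: shortest_tree_nil.
- by rewrite big1.
- by rewrite eq_card0.
- by move=> w; rewrite inE => /eqP->.
- by move=> v; rewrite mem_seen => ?; exists ord0.
Qed.

(** * One step of the exploration preserves the invariant *)

Section Advance.
Variables (st : state) (w : seq nat) (v : nat).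
Hypothesis ist : coherent st.
Hypothesis wv : (w, v) \in frontier G s (explored st).
Hypothesis min : forall e, e \in frontier G s (explored st) ->
  plen G s (rcons w v) <= plen G s (rcons e.1 e.2).

Let T := explored st.
Let i := mover st w.
Let tT : shortest_tree G s T := inv_tree ist.

Lemma tree_advance : shortest_tree G s ((w, v) :: T).
Proof. exact: shortest_tree_cons. Qed.

Lemma children_cons u :
  children s ((w, v) :: T) u = ((last s w == u) + children s T u)%N.
Proof. by []. Qed.

Let wT : w \in walks T.
Proof. by move: wv; rewrite mem_frontier => /and3P[]. Qed.

(** With nobody at the end of [w], that node already has a child and [v] becomes another; by the
    degree bound only [x] can have a parent and two children. *)
Lemma branching : w != [::] -> (forall j, pos st j <> w) ->
  last s w = x /\ s != x /\ (0 < children s T x)%N.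
Proof.
move=> w0 nw.
have ch0 : (0 < children s T (last s w))%N.
  by case: (inv_leaf ist wT w0) => // -[j /nw].
have ws : last s w != s.
  apply: contra w0 => /eqP ws; apply/eqP.
  by apply: (tree_inj tT) => //; exact: mem_head.
have := children_degree gG (last s w) tree_advance dG.
rewrite children_cons eqxx ws => h.
have wx : last s w = x by apply/eqP; move: h; case: eqP => //; lia.
by rewrite -wx eq_sym ws.
Qed.

Lemma mover_spec : (w != [::] /\ pos st i = w) \/
  (pos st i = [::] /\
   (w = [::] \/ last s w = x /\ s != x /\ (0 < children s T x)%N)).
Proof.
rewrite /i /mover; case: (pickP (fun j => pos st j == w)) => [j /eqP jw /=|nw].
  by rewrite jw; have [w0|w0] := eqVneq w [::]; [right; split=> //; left|left].
have {}nw j : pos st j <> w by move=> e; have := nw j; rewrite e eqxx.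
have br : w = [::] \/ last s w = x /\ s != x /\ (0 < children s T x)%N.
  by have [|w0] := eqVneq w [::]; [left|right; apply: branching].
right; case: pickP => [j /eqP //|n0 /=]; exfalso.
(* With no agent left at [s], all three are active. But the degree bounds hold with the child [v]
   included, which allows at most two active agents before this step. *)
have := inv_active ist; rewrite eq_cardT => [|j]; last first.
  by rewrite inE; have := n0 j => ->.
rewrite -/T size_enum_ord.
have := children_degree gG s tree_advance dG.
have := children_degree gG x tree_advance dG.
rewrite !children_cons; have [xs|xs] := eqVneq x s.
  case: br => [->|[_ [+ _]]]; last by rewrite xs eqxx.
  by rewrite /= !eqxx; lia.
case: br => [->|[-> [_ ch]]]; last by rewrite (negbTE xs) !eqxx; lia.
by rewrite /= !eqxx; lia.
Qed.

Lemma mover_prefix : exists r, w = pos st i ++ r.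
Proof.
by case: mover_spec => [[_ ->]|[-> _]]; [exists [::]; rewrite cats0|exists w].
Qed.

(** The walk [w] is split at the mover's position; [K] stays general so that it can be the
    restricted or the whole graph. *)
Lemma advanceE : exists r, [/\ w = pos st i ++ r,
  rcons w v = pos st i ++ rcons r v & forall K,
  advance K s st w v =
    State (clock st + plen K (last s (pos st i)) (rcons r v)) ((w, v) :: T)
    (fun j => if j == i then rcons w v else pos st j)
    (fun j => if j == i
      then out st i ++ legs K (clock st) (last s (pos st i)) (rcons r v)
      else out st j)].
Proof.
have [r wE] := mover_prefix; exists r; split=> //.
  by rewrite [in LHS]wE rcons_cat.
have dw : drop (size (pos st i)) w = r by rewrite [X in drop _ X]wE drop_size_cat.
by move=> K; rewrite /advance -/i dw.
Qed.

(** Every edge to be walked starts at a seen node on [w], so its length is known. *)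
Lemma advance_restrict : advance G.[& seen s T] s st w v = advance G s st w v.
Proof.
have [r [wE _ aE]] := advanceE.
have sub : {subset belast (last s (pos st i)) (rcons r v) <= seen s T}.
  move=> u; rewrite belast_rcons => ur; apply: (tree_seen tT wT).
  rewrite wE; move: ur; rewrite !inE mem_cat.
  move=> /orP[/eqP->|->]; last by rewrite !orbT.
  by have := mem_last s (pos st i); rewrite inE orbA => ->.
by rewrite !aE plen_restrict// legs_restrict.
Qed.

Lemma arrival_legs_rcons a t u r :
  arrival G a u (legs G t u (rcons r v)) =
  (t + plen G u (rcons r v), last u (rcons r v)).
Proof. by rewrite -arrival_legs; case: r => [|y r]; rewrite /= !arrival_cons. Qed.

Lemma card_active :
  (#|[pred j | (if j == i then rcons w v else pos st j) != [::]]| <=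
   (pos st i == [::]) + #|[pred j | pos st j != [::]]|)%N.
Proof.
have [p0|p0] := eqVneq (pos st i) [::] => /=; last first.
  apply/eq_leq/eq_card => j; rewrite !inE; have [->|//] := eqVneq j i.
  by rewrite p0; case: (w).
apply: leq_trans (_ : #|[predU1 i & [pred j | pos st j != [::]]]| <= _)%N.
  apply: subset_leq_card; apply/fintype.subsetP => j; rewrite !inE.
  by have [|] := eqVneq j i.
by rewrite cardU1 leq_add2r; case: (_ \in _).
Qed.

Lemma coherent_advance : coherent (advance G s st w v).
Proof.
have [r [wE wvE aE]] := advanceE; rewrite aE.
have tT' := tree_advance.
have path_r : path (adj G) (last s (pos st i)) (rcons r v).
  have : path (adj G) s (rcons w v).
    by apply: (tree_path tT'); rewrite mem_walks_cons eqxx.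
  by rewrite wvE cat_path => /andP[].
have outE : (arrival G 0 s (out st i)).2 = last s (pos st i).
  by rewrite arrival_node (inv_out ist).
split=> //=.
- move=> j; rewrite mem_walks_cons; case: ifP => _; first by rewrite eqxx.
  by rewrite (inv_pos ist) orbT.
- move=> j; case: ifP => _; last exact: (inv_feasible ist).
  apply/feasible_cat; split; first exact: (inv_feasible ist).
  by rewrite outE; apply: feasible_le (inv_arrival ist i) _; apply: feasible_legs.
- move=> j; case: ifP => _; last exact: (inv_out ist).
  by rewrite [LHS]map_cat -!/(unzip2 _) unzip2_legs (inv_out ist) -wvE.
- move=> j; case: ifP => _.
    by rewrite arrival_cat outE arrival_legs_rcons.
  apply: le_trans (inv_arrival ist j) _.
  by rewrite lerDl plen_ge0.
- rewrite (inv_clock ist) (bigD1 i)//= [RHS](bigD1 i)//= eqxx.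
  rewrite wvE [in RHS]plen_cat addrAC; congr (_ + _).
  by apply: eq_bigr => j /negbTE->.
(* An agent sent out from [s] is accounted for by a new child: of [s] if [w] is empty, otherwise of
   [x], which already had one. *)
- apply: leq_trans card_active _.
  have := inv_active ist; rewrite !children_cons -/T.
  case: mover_spec => [[w0 ->]|[-> /= [w0|[wx [sx ch]]]]].
  + rewrite (negbTE w0) add0n => /leq_trans; apply.
    by case: ifP; lia.
  + by rewrite w0 /= eqxx; case: ifP; lia.
  + by rewrite wx eqxx (negbTE sx); lia.
- move=> w'; rewrite mem_walks_cons => /orP[/eqP-> _|w'T w'0].
    by left; exists i; rewrite eqxx.
  rewrite children_cons; case: (inv_leaf ist w'T w'0) => [[j wj]|ch]; last first.
    by right; rewrite addn_gt0 ch orbT.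
  have [ji|ji] := eqVneq j i; last by left; exists j; rewrite (negbTE ji).
  (* If the mover leaves the end of [w'], then [w'] is [w], whose end now has the child [v]. *)
  right; move: wj w'0; rewrite ji; case: mover_spec => [[_ ->]|[-> _]] <- //.
  by rewrite eqxx.
- move=> v'; rewrite seen_cons in_fset1U => /orP[/eqP->|/(inv_seen ist)[j vj]].
    by exists i; rewrite eqxx inE mem_rcons mem_head orbT.
  exists j; case: eqP vj => // ->; rewrite wvE !inE mem_cat.
  by move=> /orP[->|->]; rewrite ?orbT.
Qed.

Lemma clock_advance : clock st < clock (advance G s st w v).
Proof.
have [r [wE wvE ->]] := advanceE; rewrite /= ltrDl plen_gt0//; last by case: (r).
have : path (adj G) s (rcons w v).
  by apply: (tree_path tree_advance); rewrite mem_walks_cons eqxx.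
by rewrite wvE cat_path => /andP[].
Qed.

(** The mover passes only nodes of [w], all seen already, before it reaches [v] at the very end; so
    the knowledge is constant during a step. *)
Lemma visited_advance t : clock st <= t -> t < clock (advance G s st w v) ->
  visited G s (out (advance G s st w v)) t = seen s T.
Proof.
have := coherent_advance; have [r [wE wvE aE]] := advanceE.
rewrite aE /= => ist' ct tc'; apply/fsetP => u; apply/visitedP/idP; last first.
  move=> /(inv_seen ist)[j]; rewrite -(inv_out ist) -(stops_nodes G 0 s).
  move=> /mapP[[a u'] aj /= ->]; exists j, a; split; last first.
    apply: le_trans ct; apply: le_trans (inv_arrival ist j).
    exact: (stops_le gG (inv_feasible ist j) aj).
  by case: eqP aj => // -> aj; rewrite stops_cat mem_cat aj.
have sub : {subset s :: pos st i ++ r <= seen s T}.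
  by rewrite -wE; apply: (tree_seen tT wT).
have old j a : (a, u) \in stops G 0 s (out st j) -> u \in seen s T.
  move=> aj; apply: (tree_seen tT (inv_pos ist j)).
  by rewrite -(inv_out ist) -(stops_nodes G 0 s); apply/mapP; exists (a, u).
move=> [j [a [+ at_]]]; case: eqP => [ji|_]; last exact: old.
rewrite stops_cat mem_cat => /orP[/old//|].
(* Split off the arrival at [v], which happens at the new clock time, after [t]. *)
rewrite arrival_node (inv_out ist) legs_rcons -cats1 stops_cat.
set p := last s _; set q := arrival _ _ _ _.
have -> : behead (stops G q.1 p (legs G (clock st) p r) ++
    behead (stops G (arrival G q.1 p (legs G (clock st) p r)).1
      (arrival G q.1 p (legs G (clock st) p r)).2
      [:: (clock st + plen G p r, v)])) =
    behead (stops G q.1 p (legs G (clock st) p r)) ++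
      [:: (clock st + plen G p (rcons r v), v)].
  rewrite arrival_node unzip2_legs /= plen_rcons addrA.
  by case: (legs _ _ _ _) => [|[]].
rewrite mem_cat mem_seq1 => /orP[ar|/eqP[aE' _]]; last first.
  by move: at_; rewrite aE' leNgt tc'.
apply: sub; rewrite inE mem_cat.
suff -> : u \in r by rewrite !orbT.
rewrite -(unzip2_legs G (clock st) p r).
have := stops_nodes G q.1 p (legs G (clock st) p r).
move=> /(congr1 behead) /= <-; rewrite /unzip2 behead_map.
by apply/mapP; exists (a, u).
Qed.

End Advance.

(** The restricted graph has the same frontier and the same candidate lengths as [G], so [step] acts
    like Dijkstra's algorithm on [G]. *)
Lemma stepP st : coherent st ->
  (seen s (explored st) = domf G /\ step s G st = st) \/
  exists w v, [/\ (w, v) \in frontier G s (explored st),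
    forall e, e \in frontier G s (explored st) ->
      plen G s (rcons w v) <= plen G s (rcons e.1 e.2) &
    step s G st = advance G s st w v].
Proof.
move=> ist; have tT := inv_tree ist; rewrite /step.
set T := explored st in tT *; set K := G.[& _].
have frE : frontier K s T =i frontier G s T.
  move=> [w v]; rewrite !mem_frontier.
  have [wT|//] := boolP (w \in walks T).
  by rewrite /adj edge_len_restrict// (last_seen tT wT).
have plE e : e \in frontier G s T ->
    plen K s (rcons e.1 e.2) = plen G s (rcons e.1 e.2).
  case: e => w v; rewrite mem_frontier => /and3P[wT _ _].
  by apply: plen_restrict => u; rewrite belast_rcons; apply: (tree_seen tT wT).
have := nearestP K s (frontier K s T); case: nearest => [[w v] [+ min]|f0].
  rewrite frE => wv; right; exists w, v.
  have min' e : e \in frontier G s T ->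
      plen G s (rcons w v) <= plen G s (rcons e.1 e.2).
    by move=> ef; have := min e; rewrite frE !plE//; apply.
  by split=> //; apply: advance_restrict.
left; split=> //; apply: (seen_all gG sG tT).
case E: (frontier G s T) => [//|e l].
have : e \in frontier K s T by rewrite frE E mem_head.
by rewrite f0.
Qed.

(** This lets past steps be recomputed from any later knowledge. *)
Lemma step_agree (A : {fset nat}) st : seen s (explored st) `<=` A ->
  step s G.[& A] st = step s G st.
Proof.
by move=> sub; rewrite /step restrictf_comp (fsetIidPr sub).
Qed.

End Steps.

(** * The strategy and its run *)

Section Explorer.
Variable R : realType.
Implicit Types (G K : adjmap R) (s : nat).

Definition depth K s (T : tree) : R :=
  \big[Num.max/0]_(e <- T) plen K s (rcons e.1 e.2).

(* Once everything is visited, an agent at distance [d] from [s] departs at time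
   [4 * D - d], where [D] is the largest distance, so that all agents return
   simultaneously. *)
Definition plan s K : schedule R 3 := fun i =>
  let st := iter #|` domf K| (step s K) (start R) in
  let q := pos st i in
  out st i ++
  if seen s (explored st) == domf K
  then legs K (4 * depth K s (explored st) - plen K s q)
         (last s q) (rev (belast s q))
  else [::].

(* The past moves are ignored: they can be recomputed from the knowledge. *)
Definition explorer : strategy R 3 := fun s t _ K i =>
  omap snd (ohead [seq m <- plan s K i | m.1 == t]).

Lemma depth_ge K s T w : w \in walks T -> plen K s w <= depth K s T.
Proof.
rewrite inE => /orP[/eqP->|/mapP[e + ->]].
  rewrite /depth; elim: T => [|e T IH]; first by rewrite big_nil.
  by rewrite big_cons le_max IH orbT.
rewrite /depth; elim: T => [//|f T IH]; rewrite inE big_cons le_max.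
by move=> /orP[/eqP->|/IH->]; rewrite ?lexx ?orbT.
Qed.

Lemma depth_walk K s T : exists2 w, w \in walks T & plen K s w = depth K s T.
Proof.
rewrite /depth; elim: T => [|f T [w wT wd]].
  by exists [::]; rewrite ?big_nil.
rewrite big_cons; have [le|/ltW le] := leP (plen K s (rcons f.1 f.2))
  (\big[Num.max/0]_(e <- T) plen K s (rcons e.1 e.2)).
  exists w => //; case: f {le} => f1 f2.
  by rewrite mem_walks_cons wT orbT.
by exists (rcons f.1 f.2) => //; apply: mem_walks; rewrite mem_head.
Qed.

Lemma commandP G t u (p : itinerary R) d v : is_graph G -> feasible G t u p ->
  (d, v) \in p <-> omap snd (ohead [seq m <- p | m.1 == d]) = Some v.
Proof.
move=> gG f; split=> [dp|].
  case E: [seq m <- p | m.1 == d] => [|[d' v'] l].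
    have : (d, v) \in [seq m <- p | m.1 == d] by rewrite mem_filter eqxx dp.
    by rewrite E.
  have : (d', v') \in [seq m <- p | m.1 == d] by rewrite E mem_head.
  rewrite mem_filter /= => /andP[/eqP-> v'p].
  by rewrite (feasible_inj gG f dp v'p).
case E: [seq m <- p | m.1 == d] => [|[d' v'] l] //= [<-].
have : (d', v') \in [seq m <- p | m.1 == d] by rewrite E mem_head.
by rewrite mem_filter /= => /andP[/eqP->].
Qed.

Variables (G : adjmap R) (s x : nat).
Hypothesis gG : is_graph G.
Hypothesis sG : s \in domf G.
Hypothesis dG : degree_le_2_except G x.

Definition stage n : state R := iter n (step s G) (start R).

Let V n := seen s (explored (stage n)).
Let tau n := clock (stage n).
Let node n i := last s (pos (stage n) i).

(** [S] continues stage [n]: all moves beyond those of the stage depart at time [tau n] or later. *)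
Definition extends n (S : schedule R 3) := forall i,
  exists p, S i = out (stage n) i ++ p /\ feasible G (tau n) (node n i) p.

Lemma stageS n : stage n.+1 = step s G (stage n).
Proof. exact: iterS. Qed.

Lemma coherent_stage n : coherent G s x (stage n).
Proof.
elim: n => [|n IH]; first exact: coherent_start.
rewrite /stage iterS -/(stage n).
have [[_ ->] //|[w [v [wv min ->]]]] := stepP gG sG dG IH.
exact: coherent_advance.
Qed.

(** Either everything is seen and the stage no longer changes, or the next stage makes strict
    progress and keeps all earlier moves. *)
Lemma stage_next n : (V n = domf G /\ stage n.+1 = stage n) \/
  [/\ V n <> domf G, tau n < tau n.+1,
      V n `<=` V n.+1 /\
      size (explored (stage n.+1)) = (size (explored (stage n))).+1,
      forall t, tau n <= t -> t < tau n.+1 ->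
        visited G s (out (stage n.+1)) t = V n &
      extends n (out (stage n.+1))].
Proof.
have ist := coherent_stage n.
rewrite /tau /V /extends /node [stage n.+1]iterS -/(stage n).
have [|[w [v [wv min stE]]]] := stepP gG sG dG ist; first by left.
right; have ist' := coherent_advance gG sG dG ist wv min; rewrite stE; split.
- by move=> /(frontier_all gG) f0; rewrite f0 in wv.
- exact: (clock_advance gG sG dG ist wv min).
- split; last by [].
  by apply/fsubsetP => u uV; rewrite seen_cons in_fset1U uV orbT.
- exact: (visited_advance gG sG dG ist wv min).
move=> i; have := inv_feasible ist' i.
have [r [_ _ ->]] := advanceE gG sG dG ist wv min.
move=> /=; case: eqP => [->|_] f; last by exists [::]; rewrite cats0.
exists (legs G (clock (stage n)) (last s (pos (stage n) (mover (stage n) w)))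
  (rcons r v)).
split=> //; apply: feasible_legs.
move: f => /feasible_cat[_] /feasible_path.
by rewrite unzip2_legs arrival_node (inv_out ist).
Qed.

Lemma arrival_cons_start a t u (p : itinerary R) : p != [::] ->
  arrival G a u p = arrival G t u p.
Proof. by case: p => [|[d v] p] // _; rewrite !arrival_cons. Qed.

Lemma arrival_out n i : arrival G 0 s (out (stage n) i) =
  ((arrival G 0 s (out (stage n) i)).1, node n i).
Proof.
rewrite [LHS]surjective_pairing; congr (_, _).
by rewrite arrival_node (inv_out (coherent_stage n)).
Qed.

Lemma tau_le n : tau n <= tau n.+1.
Proof.
have [[_ e]|[_ /ltW ? _ _ _]] := stage_next n; last by [].
by rewrite /tau e.
Qed.

Lemma V_sub m n : (m <= n)%N -> V m `<=` V n.
Proof.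
move=> /subnK <-; elim: (n - m)%N => [|k IH]; first exact: fsubset_refl.
apply: fsubset_trans IH _; rewrite addSn.
have [[_ e]|[_ _ [+ _] _ _]] := stage_next (k + m); last by [].
by rewrite /V e fsubset_refl.
Qed.

Lemma extends_feasible n S i : extends n S -> feasible G 0 s (S i).
Proof.
move=> /(_ i)[p [-> fp]]; apply/feasible_cat.
split; first exact: (inv_feasible (coherent_stage n)).
rewrite arrival_out; apply: feasible_le fp.
exact: (inv_arrival (coherent_stage n)).
Qed.

Lemma extends_pred n S : extends n.+1 S -> extends n S.
Proof.
move=> eS i; have [[_ e]|[_ _ _ _ en]] := stage_next n.
  by move: (eS i); rewrite /tau /node e.
have [p2 [-> f2]] := eS i; have [p1 [e1 f1]] := en i.
exists (p1 ++ p2); rewrite e1 catA; split=> //.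
apply/feasible_cat; split=> //.
have aE : (arrival G (tau n) (node n i) p1).1 <= tau n.+1.
  have [->|p0] := eqVneq p1 [::]; first exact: tau_le.
  have := inv_arrival (coherent_stage n.+1) i.
  by rewrite e1 arrival_cat arrival_out (arrival_cons_start _ (tau n)).
apply: feasible_le aE _.
suff -> : (arrival G (tau n) (node n i) p1).2 = node n.+1 i by [].
rewrite arrival_node /node -!(inv_out (coherent_stage _)) e1.
by rewrite /unzip2 map_cat last_cat.
Qed.

Lemma extends_le m n S : (m <= n)%N -> extends n S -> extends m S.
Proof.
move=> /subnK <-; elim: (n - m)%N => [//|k IH].
by rewrite addSn => /extends_pred.
Qed.

Lemma extends_moves_before n S t i : extends n S -> t <= tau n ->
  moves_before t (S i) = moves_before t (out (stage n) i).
Proof.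
move=> /(_ i)[p [-> fp]] tn; exact: (moves_before_cat gG _ fp tn).
Qed.

Lemma extends_visited n S t : extends n S -> t <= tau n ->
  visited G s S t = visited G s (out (stage n)) t.
Proof.
move=> eS tn; rewrite [LHS](visited_moves_before gG); last first.
  by move=> i; apply: extends_feasible eS.
rewrite [RHS](visited_moves_before gG); last first.
  exact: (inv_feasible (coherent_stage n)).
by congr (visited _ _ _ _); apply/funext => i; apply: extends_moves_before.
Qed.

Lemma extends_mem n S t v i : extends n S -> t < tau n ->
  ((t, v) \in S i) = ((t, v) \in out (stage n) i).
Proof.
move=> eS tn; have := extends_moves_before i eS (lexx _) => e.
have mE (p : itinerary R) : ((t, v) \in p) = ((t, v) \in moves_before (tau n) p).
  by rewrite mem_filter tn.
by rewrite mE e -mE.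
Qed.

Lemma stage_size n : V n <> domf G -> size (explored (stage n)) = n.
Proof.
elim: n => [//|n IH].
have [[a e]|[a _ [_ sz] _ _] _] := stage_next n; last by rewrite sz IH.
by rewrite /V e.
Qed.

Lemma card_V n : #|` V n| = (size (explored (stage n))).+1.
Proof.
rewrite card_fseq undup_id ?(tree_uniq (inv_tree (coherent_stage n)))//.
by rewrite /= size_map.
Qed.

Let M := #|` domf G|.

(** Each step before completion adds a node, so an incomplete stage [M] would have seen [M + 1] of
    the [M] nodes. *)
Lemma V_all : V M = domf G.
Proof.
have [//|/eqP/stage_size sz] := eqVneq (V M) (domf G).
have := fsubset_leq_card (seen_domf gG sG (inv_tree (coherent_stage M))).
by rewrite -/(V M) card_V sz ltnn.
Qed.

Let D := depth G s (explored (stage M)).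
Let home i := legs G (4 * D - plen G s (pos (stage M) i)) (node M i)
  (rev (belast s (pos (stage M) i))).
Let S := plan s G.

Lemma planE i : S i = out (stage M) i ++ home i.
Proof. by rewrite /S /plan -/M -/(stage M) -/(V M) V_all eqxx. Qed.

Lemma pos_path i : path (adj G) s (pos (stage M) i).
Proof.
have ist := coherent_stage M.
exact: (tree_path (inv_tree ist) (inv_pos ist i)).
Qed.

Lemma pos_depth i : plen G s (pos (stage M) i) <= D.
Proof. exact: depth_ge (inv_pos (coherent_stage M) i). Qed.

Lemma depth_ge0 : 0 <= D.
Proof. by apply: le_trans (pos_depth ord0); rewrite plen_ge0// pos_path. Qed.

Lemma tau_depth : tau M <= 3 * D.
Proof.
rewrite /tau (inv_clock (coherent_stage M)).
apply: le_trans (ler_sum _ (fun i _ => pos_depth i)) _.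
by rewrite sumr_const card_ord mulr_natl lexx.
Qed.

Lemma extends_plan : extends M S.
Proof.
move=> i; rewrite planE; exists (home i); split=> //.
apply: feasible_le (feasible_legs _ (path_rev_belast gG (pos_path i))).
(* The way home starts at time [3 * D] or later, hence not before the exploring phase ends. *)
by have := tau_depth; have := pos_depth i; lra.
Qed.

(** Time 0 belongs to the agents that never leave [s]. *)
Lemma arrival_plan i : arrival G 0 s (S i) =
  (if pos (stage M) i == [::] then 0 else 4 * D, s).
Proof.
rewrite planE arrival_cat arrival_out /home /node; set q := pos _ _.
have: unzip2 (out (stage M) i) = q := inv_out (coherent_stage M) i.
case: eqP => [->|/eqP q0 _]; first by case: (out _ _).
rewrite (arrival_cons_start _ (4 * D - plen G s q)); last first.
  by case/lastP: q q0 => // q y _; rewrite belast_rcons rev_cons; case: (rev q).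
rewrite arrival_legs (plen_rev_belast gG) last_rev_belast.
by rewrite subrK.
Qed.

Lemma arrival_plan_le i : (arrival G 0 s (S i)).1 <= 4 * D.
Proof. by rewrite arrival_plan /=; case: ifP => //; have := depth_ge0; lra. Qed.

Lemma visited_late t : tau M <= t -> visited G s S t = domf G.
Proof.
move=> tt; apply/eqP; rewrite eqEfsubset; apply/andP; split; apply/fsubsetP => v.
  move=> /visitedP[i [a [ai _]]].
  have : v \in unzip2 (stops G 0 s (S i)) by apply/mapP; exists (a, v).
  rewrite stops_nodes; have := feasible_path (extends_feasible i extends_plan).
  move=> /[swap] /splitPl[p1 p2 <-]; rewrite cat_path => /andP[p1G _].
  exact: path_domf p1G.
rewrite -V_all => /(inv_seen (coherent_stage M))[i].
rewrite -(inv_out (coherent_stage M)) -(stops_nodes G 0 s).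
move=> /mapP[[a u] ai /= ->]; apply/visitedP; exists i, a.
rewrite planE stops_cat mem_cat ai; split=> //.
apply: le_trans tt; apply: le_trans (inv_arrival (coherent_stage M) i).
exact: (stops_le gG (inv_feasible (coherent_stage M) i) ai).
Qed.

Lemma find_stage t : 0 <= t -> t < tau M ->
  exists n, [/\ (n < M)%N, tau n <= t & t < tau n.+1].
Proof.
move=> t0; elim: M => [|m IH] tm.
  by move: (lt_le_trans tm t0); rewrite /tau ltxx.
have [/IH[n [nm ? ?]]|mt] := ltP t (tau m); last by exists m.
by exists n; rewrite (ltn_trans nm).
Qed.

Lemma visited_early n t : (n < M)%N -> tau n <= t -> t < tau n.+1 ->
  visited G s S t = V n /\ V n <> domf G.
Proof.
move=> nM nt tn; rewrite (extends_visited (extends_le nM extends_plan) (ltW tn)).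
have [[_ e]|[nV _ _ v _]] := stage_next n; last by rewrite v.
by move: (le_lt_trans nt tn); rewrite /tau e ltxx.
Qed.

Lemma node_at_ge0 (p : itinerary R) t : feasible G 0 s p ->
  node_at G s p t <> None -> 0 <= t.
Proof.
move=> f; rewrite leNgt => n; apply/negP => t0; apply: n.
by rewrite /node_at (moves_before_nil gG f (ltW t0)) /= leNgt t0.
Qed.

(** As [s] can occur only as the end of the walk, a last arrival at [s] is the final one, which lies
    after [t]. *)
Lemma late_node u t0 t r : path (adj G) u r -> s \notin belast u r ->
  t < t0 + plen G u r ->
  let a := arrival G t0 u (moves_before t (legs G t0 u r)) in
  a.2 = s -> t < a.1.
Proof.
elim: r u t0 => [|v r IH] u t0; first by rewrite /= addr0.
move=> /[dup] pr /= /andP[uv vr].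
rewrite inE negb_or => /andP[su sr]; rewrite addrA => tt.
have [t0t|t0t] := ltP t0 t; first by rewrite arrival_cons; apply: IH.
have := moves_before_nil gG (feasible_legs t0 pr) t0t.
rewrite /= ltNge t0t /= -/(moves_before t _) => -> /= us.
by rewrite us eqxx in su.
Qed.

Lemma run_plan : 0 < D -> run explorer G s S (4 * D).
Proof.
move=> D0; have eS := extends_plan.
have fS i : feasible G 0 s (S i) := extends_feasible i eS.
have ltS i m : m \in S i -> m.1 < 4 * D.
  move=> mi; apply: lt_le_trans (arrival_plan_le i).
  exact: (feasible_lt_arrival gG (fS i) mi).
have tD := tau_depth.
split; last first.
  move=> t i tT /(node_at_ge0 (fS i)) t0 v; rewrite /explorer /knowledge.
  (* From time [tau M] on the whole graph is known, and the recomputed plan is [S] itself. *)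
  have [tl|tl] := leP (tau M) t.
    rewrite visited_late// restrictfT; exact: commandP (fS i).
  have [n [nM nt tn]] := find_stage t0 tl.
  have [-> nV] := visited_early nM nt tn.
  have VG : V n `<=` domf G := seen_domf gG sG (inv_tree (coherent_stage n)).
  (* The knowledge has [n + 1] nodes, so the plan computed from it runs one step beyond stage [n]:
     the step under way at time [t]. *)
  have cV : #|` V n| = n.+1 by rewrite card_V stage_size.
  have agree k : (k <= n.+1)%N -> iter k (step s G.[& V n]) (start R) = stage k.
    elim: k => [|k IH] kn; first exact: erefl.
    rewrite iterS (IH (ltnW kn)) stageS; apply: step_agree; exact: V_sub.
  have -> : plan s G.[& V n] i = out (stage n.+1) i.
    rewrite /plan domf_restrict (fsetIidPl VG) cV agree//.
    (* No return is planned yet: the simulated step sees one node more than the knowledge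
       contains. *)
    case: eqP => [e|_]; last by rewrite cats0.
    have := card_V n.+1; rewrite /V e cV.
    have [[/nV//]|[_ _ [_ ->] _ _]] := stage_next n.
    by rewrite stage_size// => -[]; lia.
  rewrite (extends_mem _ _ (extends_le nM eS) tn).
  exact: commandP (inv_feasible (coherent_stage n.+1) i).
split=> // [|t tT [dV nT]].
  split=> [|i]; first by rewrite visited_late ?fsubset_refl//; lra.
  rewrite /node_at last_stops (moves_before_all gG (fS i) (arrival_plan_le i)).
  by rewrite arrival_plan_le arrival_plan.
have t0 : 0 <= t by apply: (node_at_ge0 (fS ord0)); rewrite nT.
have [tl|tl] := leP (tau M) t; last first.
  have [n [nM nt tn]] := find_stage t0 tl.
  have [e nV] := visited_early nM nt tn; apply: nV.
  apply/eqP; rewrite eqEfsubset -{2}e dV andbT.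
  exact: (seen_domf gG sG (inv_tree (coherent_stage n))).
(* As [0 < D], some agent has left [s]: otherwise only [s] would be seen and the deepest walk would
   be empty. *)
have [i q0] : exists i, pos (stage M) i != [::].
  apply/existsP; rewrite -[[exists _, _]]negbK negb_exists.
  apply/negP => /forallP q0.
  have [w wT wD] := depth_walk G s (explored (stage M)).
  have : last s w \in V M by apply: last_seen (inv_tree (coherent_stage M)) wT.
  move=> /(inv_seen (coherent_stage M))[i].
  move: (q0 i); rewrite negbK => /eqP->; rewrite inE => /eqP ws.
  have nilT : [::] \in walks (explored (stage M)) by exact: mem_head.
  have w0 : w = [::] := tree_inj (inv_tree (coherent_stage M)) wT nilT ws.
  by move: wD D0; rewrite w0 /= /D => <-; rewrite ltxx.
have := nT i; rewrite /node_at last_stops planE /moves_before filter_cat.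
rewrite -!/(moves_before _ _).
rewrite (moves_before_all gG (inv_feasible (coherent_stage M) i)); last first.
  exact: le_trans (inv_arrival (coherent_stage M) i) tl.
rewrite arrival_cat arrival_out; case: ifP => // at_ [aS].
have uq := tree_uniq_walk (inv_tree (coherent_stage M))
  (inv_pos (coherent_stage M) i).
have sq : s \notin belast (node M i) (rev (belast s (pos (stage M) i))).
  move: uq q0; rewrite /node; case/lastP: (pos _ _) => // q y.
  rewrite last_rcons belast_rcons rev_cons belast_rcons inE mem_rev.
  by rewrite /= mem_rcons inE => /andP[].
(* Before its way home the agent is at the end of a nonempty walk without repetitions, thus not at
   [s]; on its way home [late_node] applies. *)
have [h0|h0] := eqVneq (moves_before t (home i)) [::].
  move: aS uq q0; rewrite h0 /= /node; case/lastP: (pos _ _) => // q y.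
  by rewrite last_rcons mem_rcons => ->; rewrite mem_head.
move: at_ aS.
rewrite (arrival_cons_start _ (4 * D - plen G s (pos (stage M) i)) _ h0).
rewrite leNgt => /negP at_ /late_node aS; apply/at_/aS => //.
  exact: path_rev_belast (pos_path i).
by rewrite /node (plen_rev_belast gG) subrK.
Qed.

End Explorer.

(** * Cost bounds on tadpoles and the two ratios *)

Lemma explorer_run (R : realType) (G : adjmap R) s : is_graph G -> tadpole G ->
  s \in domf G -> exists S w,
  [/\ run (@explorer R) G s S (4 * plen G s w), 0 < plen G s w,
      [/\ path (adj G) s w, shortest G s w & last s w \in domf G] &
      forall i, travelled G s (S i) <= plen G s w *+ 2].
Proof.
move=> gG tG sG; have [x dG] := tadpole_degree tG.
(* A tree walk of maximal length serves as [w]; it has positive length since a tadpole has nodes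
   other than [s]. *)
have [w wT wD] := depth_walk G s (explored (stage G s #|` domf G|)).
have tT := inv_tree (coherent_stage gG sG dG #|` domf G|).
have D0 : 0 < plen G s w.
  have [v vG vs] : exists2 v, v \in enum_fset (domf G) & v != s.
    have [y [c [t [uq c2 t1 dE _]]]] := tG.
    apply/hasP/negPn/negP => /hasPn h.
    have : (size (y :: c ++ t) <= size [:: s])%N.
      apply: uniq_leq_size => // v; rewrite -dE => vG; rewrite inE.
      by have := h v vG; rewrite negbK.
    by rewrite /= size_cat; lia.
  have := V_all gG sG dG => VG.
  have [w' w'T w'v] := seen_walk (etrans (congr1 (fun A => v \in A) VG) vG).
  rewrite wD; apply: lt_le_trans (depth_ge G s w'T).
  apply: plen_gt0 (tree_path tT w'T) _ => //.
  by apply: contra vs => /eqP w'0; rewrite -w'v w'0.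
exists (plan s G), w; split=> //.
- by rewrite wD; apply: run_plan dG _; rewrite // -wD.
- split; [exact: tree_path tT _ wT | exact: tree_shortest tT _ wT |].
  exact: (fsubsetP (seen_domf gG sG tT) _ (last_seen tT wT)).
move=> i; rewrite travelled_plen (planE gG sG dG) /unzip2 map_cat -!/(unzip2 _).
rewrite unzip2_legs (inv_out (coherent_stage gG sG dG _)) plen_cat.
rewrite (plen_rev_belast gG) -mulr2n ler_wMn2r// wD.
exact: (pos_depth gG sG dG).
Qed.

Lemma explorer_explores (R : realType) :
  explores_all (@tadpole R) (@explorer R).
Proof.
move=> G s gG tG sG; have [S [w [rS _ _ _]]] := explorer_run gG tG sG.
by exists S, (4 * plen G s w).
Qed.

Theorem theorem8 (R : realType) :
  exists sigma : strategy R 3,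
    has_competitive_ratio Time (@tadpole R) sigma 2 /\
    has_competitive_ratio Energy (@tadpole R) sigma 1.
Proof.
exists (@explorer R).
split; split; [exact: explorer_explores| |exact: explorer_explores|].
- split=> [_ [G [s [S [T [gG tG sG rS ->]]]]]|b ub].
    have [S' [w [rS' w0 [pw sw wG] _]]] := explorer_run gG tG sG.
    have [-> _] := run_unique gG rS rS'.
    (* With [D] the length of [w], the finishing time [4 * D] is compared with an optimum of at
       least [2 * D]. *)
    have := opt_ge gG Time rS'.1 pw sw wG; rewrite mulr2n => le.
    by rewrite /= ler_pdivrMr; lra.
  (* Tightness: here the optimum is at most 2, while [w] has length at least 1 and the finishing
     time is four times that. *)
  have gU := unit_tadpole_graph R; have tU := unit_tadpole_tadpole R.
  have s0 : 0%N \in domf (unit_tadpole R) by rewrite domf_unit.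
  have [S [w [rS w0 [pw sw wG] _]]] := explorer_run gU tU s0.
  apply: (le_trans _ (ub (4 * plen (unit_tadpole R) 0 w /
    opt Time (unit_tadpole R) 0 3) _)).
    have := opt_ge gU Time rS.1 pw sw wG; rewrite mulr2n => le.
    rewrite ler_pdivlMr; last by lra.
    have := opt_unit R; suff : 1 <= plen (unit_tadpole R) 0 w by lra.
    case: (w) pw w0 => [|v w'] /=; first by rewrite ltxx.
    by move=> /andP[vw pw'] _; rewrite len_unit// lerDl plen_ge0.
  by exists (unit_tadpole R), 0%N, S, (4 * plen (unit_tadpole R) 0 w).
(* In the energy model every run is optimal: with [D] the length of [w],
   [cost <= 2 * D <= opt <= cost]. *)
have ratio1 (G : adjmap R) s S T : is_graph G -> tadpole G -> s \in domf G ->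
    run (@explorer R) G s S T -> cost Energy G s S T / opt Energy G s 3 = 1.
  move=> gG tG sG rS; have [S' [w [rS' w0 [pw sw wG] tr]]] := explorer_run gG tG sG.
  have [-> ->] := run_unique gG rS rS'.
  have ge := opt_ge gG Energy rS'.1 pw sw wG.
  have le := opt_le gG Energy sG rS'.1.
  have cw : cost Energy G s S' (4 * plen G s w) <= plen G s w *+ 2.
    by apply/bigmax_leP; split=> // ; rewrite mulrn_wge0// ltW.
  have -> : cost Energy G s S' (4 * plen G s w) = opt Energy G s 3.
    by apply/eqP; rewrite eq_le le (le_trans cw ge).
  rewrite divff// gt_eqF//; apply: lt_le_trans ge.
  by rewrite pmulrn_lgt0.
split=> [_ [G [s [S [T [gG tG sG rS ->]]]]]|b ub].
  by rewrite ratio1.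
(* One instance shows that the ratio 1 occurs, so no smaller upper bound exists. *)
have gU := unit_tadpole_graph R; have tU := unit_tadpole_tadpole R.
have s0 : 0%N \in domf (unit_tadpole R) by rewrite domf_unit.
have [S [T rS]] := explorer_explores gU tU s0.
rewrite -(ratio1 _ _ _ _ gU tU s0 rS); apply: ub.
by exists (unit_tadpole R), 0%N, S, T.
Qed.
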